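(* For every integer $n\geq 3$, there is no lattice tiling of $\mathbb{Z}^n$ by $S(n,2)$.
   Context: For $n\ge 1$ and $r\ge 0$, the Lee sphere of radius $r$ is $S(n,r)=\{(x_1,\dots,x_n)\in\mathbb{Z}^n:\sum_{i=1}^n|x_i|\le r\}$. A tiling of $\mathbb{Z}^n$ by $S(n,r)$ is a set $C\subseteq\mathbb{Z}^n$ such that the translates $\{S(n,r)+c: c\in C\}$ form a partition of $\mathbb{Z}^n$; it is a lattice tiling if moreover $C$ is a lattice (an additive subgroup of $\mathbb{Z}^n$). *)

(* Defs.v *)
From mathcomp Require Import all_boot all_order all_algebra.
From mathcomp Require Import boolp classical_sets.

Local Open Scope ring_scope.
Local Open Scope classical_set_scope.

Definition lee_sphere (n r : nat) : set 'rV[int]_n :=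
  [set x : 'rV[int]_n | \sum_(i < n) `|x 0 i| <= r%:Z].

Definition lee_translate (n r : nat) (c : 'rV[int]_n) : set 'rV[int]_n :=
  [set s + c | s in lee_sphere n r].

(* The translates are indexed by their centres; since a Lee sphere is finite
   and nonempty, distinct centres give distinct translates, so this is the
   same as a partition into the set of translates. *)
Definition tiling (n r : nat) (C : set 'rV[int]_n) : Prop :=
  partition C (lee_translate n r) setT.

Definition lattice_tiling (n r : nat) (C : set 'rV[int]_n) : Prop :=
  tiling n r C /\ GRing.zmod_closed (mem C).

(* Main.v *)
Require Import Defs.
From HB Require Import structures.
From mathcomp Require Import boolp classical_sets.
From mathcomp Require Import all_boot all_order all_algebra.
From mathcomp Require Import zify ring.

Set Implicit Arguments.
Unset Strict Implicit.
Unset Printing Implicit Defensive.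

Import Order.TTheory GRing.Theory Num.Theory.
Local Open Scope ring_scope.

(** A lattice tiling [C] makes [G = Z^n / C] a group of order [N = 2n^2 + 2n + 1],
    and the image [T] of the unit Lee sphere satisfies [T^2 = 2 G - T(2) + 2n] in the
    integral group ring, where [T(k)] is the image of [T] under [x -> k x].  This
    equation gives the first two moments of the coefficients [m] of [T(2) T] and [w]
    of [T(4) T].  On the other hand [T^3 = T(3)] modulo 3 and [T^5 = T(5)] modulo 5
    fix [m] modulo 3 and [w] modulo 5.

    If 3 divides [n], the coefficients [m] are so close to their minimal values that
    the second moment is only reachable by one huge coefficient, which the symmetry
    [x -> - x] forbids; the exception [n = 3] falls to the first moment of [w].
    Otherwise the second moment of [m] is the smallest one compatible with the
    congruences, hence [m] is known exactly; then [w] modulo 5 is known and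
    contradicts its first or second moment, unless 5 divides [n].  In that last case
    the moments force [T(4) = T], so [m] is invariant under doubling, which is
    incompatible with its known values. *)

(** * The integral group ring of a finite abelian group *)

(** The alias carries convolution as its multiplication, so products in [galg G] are never
    pointwise. *)
Definition galg (G : finZmodType) := {ffun G -> int}.

HB.instance Definition _ (G : finZmodType) := GRing.Zmodule.on (galg G).

Section GroupAlgebra.

Variable G : finZmodType.
Implicit Types (f h : galg G) (x y : G).

Definition gmul f h : galg G := [ffun x => \sum_y f y * h (x - y)].
Definition gbase x : galg G := [ffun y => (y == x)%:R].

Fact gmulC : commutative gmul.
Proof.
move=> f h; apply/ffunP=> x; rewrite !ffunE.
rewrite (reindex_inj (can_inj (subKr x))); apply: eq_bigr => y _.
by rewrite subKr mulrC.
Qed.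

Fact gmulA : associative gmul.
Proof.
move=> f h k; apply/ffunP=> x; rewrite !ffunE.
under [RHS]eq_bigr => y _ do rewrite ffunE mulr_suml.
rewrite exchange_big; apply: eq_bigr => z _ /=.
rewrite ffunE mulr_sumr [RHS](reindex_inj (addIr z)); apply: eq_bigr => y _ /=.
by rewrite addrK mulrA [y + z]addrC opprD addrA.
Qed.

Fact gmul1 : left_id (gbase 0) gmul.
Proof.
move=> f; apply/ffunP=> x; rewrite ffunE (bigD1 0) //= ffunE eqxx mul1r subr0.
by rewrite big1 ?addr0 // => y /negbTE y0; rewrite ffunE y0 mul0r.
Qed.

Fact gmulDl : left_distributive gmul +%R.
Proof.
move=> f h k; apply/ffunP=> x; rewrite !ffunE -big_split.
by apply: eq_bigr => y _; rewrite ffunE mulrDl.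
Qed.

Fact gbase0_neq0 : gbase 0 != 0.
Proof. by apply/eqP => /ffunP /(_ 0); rewrite !ffunE eqxx. Qed.

HB.instance Definition _ :=
  GRing.Zmodule_isComNzRing.Build (galg G) gmulA gmulC gmul1 gmulDl gbase0_neq0.

Lemma gmulE f h x : (f * h) x = \sum_y f y * h (x - y).
Proof. by rewrite [f * h]/(gmul f h) ffunE. Qed.

Lemma goneE x : (1 : galg G) x = (x == 0)%:R.
Proof. by rewrite [1 : galg G]/(gbase 0) ffunE. Qed.

Lemma gaddE f h x : (f + h) x = f x + h x. Proof. by rewrite ffunE. Qed.

Lemma goppE f x : (- f) x = - f x. Proof. by rewrite ffunE. Qed.

Lemma gsumE (I : Type) (r : seq I) (P : pred I) (F : I -> galg G) x :
  (\sum_(i <- r | P i) F i) x = \sum_(i <- r | P i) F i x.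
Proof.
by elim/big_rec2: _ => [|i a b _ <-]; rewrite ?ffunE.
Qed.

Lemma gnatmulE (k : nat) f x : (k%:R * f) x = k%:R * f x.
Proof.
elim: k => [|k IH]; first by rewrite !mul0r ffunE.
by rewrite -natr1 mulrDl gaddE IH !mul1r -natr1 mulrDl mul1r.
Qed.

Lemma gnatE (k : nat) x : (k%:R : galg G) x = k%:R * (x == 0)%:R.
Proof. by rewrite -[k%:R]mulr1 gnatmulE goneE. Qed.

Lemma gbaseM x y : gbase x * gbase y = gbase (x + y).
Proof.
apply/ffunP=> z; rewrite gmulE (bigD1 x) //= !ffunE eqxx mul1r.
rewrite big1 ?addr0 => [|u /negbTE ux]; last by rewrite !ffunE ux mul0r.
by rewrite subr_eq addrC.
Qed.

Lemma gbaseX x k : gbase x ^+ k = gbase (x *+ k).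
Proof. by elim: k => [|k IH] //; rewrite exprS IH gbaseM mulrS. Qed.

Definition gset (A : {set G}) : galg G := [ffun x => (x \in A)%:R].

Lemma gset_sum A : gset A = \sum_(x in A) gbase x.
Proof.
apply/ffunP=> y; rewrite gsumE ffunE; case: (boolP (y \in A)) => yA.
  rewrite (bigD1 y) //= ffunE eqxx big1 ?addr0 // => x /andP[_ xy].
  by rewrite ffunE eq_sym (negbTE xy).
by rewrite big1 // => x xA; rewrite ffunE; case: eqP => // yx; rewrite yx xA in yA.
Qed.

Definition gaug f : int := \sum_x f x.

Lemma gaugM f h : gaug (f * h) = gaug f * gaug h.
Proof.
rewrite /gaug; under eq_bigr => x _ do rewrite gmulE.
rewrite exchange_big mulr_suml; apply: eq_bigr => y _ /=.
rewrite -mulr_sumr (reindex_inj (addIr y)); congr (_ * _).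
by apply: eq_bigr => x _; rewrite addrK.
Qed.

Lemma gaug_set A : gaug (gset A) = #|A|%:R.
Proof.
rewrite /gaug -sum1_card natr_sum [RHS]big_mkcond.
by apply: eq_bigr => x _; rewrite ffunE; case: ifP.
Qed.

Lemma gmul_setT f : gset [set: G] * f = gset [set: G] * (gaug f)%:~R.
Proof.
have E (c : int) x : (gset [set: G] * c%:~R) x = c.
  rewrite gmulE (bigD1 x) //= ffunE in_setT mul1r.
  have Ec y : (c%:~R : galg G) y = c * (y == 0)%:R.
    case: c => k; first by rewrite -pmulrn gnatE natz.
    by rewrite NegzE mulrNz -pmulrn goppE gnatE natz mulNr.
  rewrite Ec subrr eqxx mulr1 big1 ?addr0 // => y xy.
  by rewrite Ec subr_eq0 eq_sym (negbTE xy) mulr0 mulr0.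
apply/ffunP=> x; rewrite E mulrC gmulE; apply: eq_bigr => y _.
by rewrite ffunE in_setT mulr1.
Qed.

(** The ring endomorphism induced by [x -> k x]; it sends [T] to the [T(k)] of the overview. *)
Definition gpush (k : nat) f : galg G := [ffun x => \sum_(y | y *+ k == x) f y].

Fact gpush_is_zmod_morphism k : zmod_morphism (gpush k).
Proof.
move=> f h; apply/ffunP=> x; rewrite !ffunE -sumrB.
by apply: eq_bigr => y _; rewrite !ffunE.
Qed.

HB.instance Definition _ k :=
  GRing.isZmodMorphism.Build (galg G) (galg G) (gpush k) (gpush_is_zmod_morphism k).

Lemma gpush_base k x : gpush k (gbase x) = gbase (x *+ k).
Proof.
apply/ffunP=> y; rewrite !ffunE; case: (eqVneq y (x *+ k)) => [->|yx].
  rewrite (bigD1 x) //= ffunE eqxx big1 ?addr0 // => z /andP[_ /negbTE zx].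
  by rewrite ffunE zx.
rewrite big1 // => z /eqP zy; rewrite ffunE; case: eqP => // zx.
by rewrite -zy zx eqxx in yx.
Qed.

Lemma gpushM k : {morph gpush k : f h / f * h}.
Proof.
move=> f h; apply/ffunP=> x; rewrite gmulE ffunE.
under eq_bigr => y _ do rewrite gmulE.
rewrite exchange_big /=.
under [RHS]eq_bigr => u _ do rewrite ffunE mulr_suml.
rewrite [RHS](exchange_big_dep predT) //=; apply: eq_bigr => z _.
rewrite [RHS](big_pred1 (z *+ k)) => [|u]; last by rewrite /= eq_sym.
rewrite ffunE -mulr_sumr; congr (_ * _).
rewrite [RHS](reindex_inj (addIr (- z))); apply: eq_bigl => y.
by rewrite mulrnBl (inj_eq (addIr _)).
Qed.

Lemma gpush1 k : gpush k 1 = 1.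
Proof. by rewrite [1]/(gbase 0) gpush_base mul0rn. Qed.

Lemma gpush_nat k m : gpush k m%:R = m%:R.
Proof. by rewrite raddfMn /= gpush1. Qed.

Lemma gpush_comp k l f : gpush k (gpush l f) = gpush (l * k)%N f.
Proof.
apply/ffunP=> x; rewrite !ffunE; under eq_bigr => y _ do rewrite ffunE.
rewrite (exchange_big_dep (fun y => y *+ (l * k)%N == x)) => [|i j /eqP<- /eqP <-] /=; last first.
  by rewrite mulrnA.
apply: eq_bigr => y /eqP yx; rewrite (big_pred1 (y *+ l)) // => z.
by apply/andP/eqP => [[_ /eqP->]|->] //; rewrite -mulrnA yx !eqxx.
Qed.

Lemma gaug_push k f : gaug (gpush k f) = gaug f.
Proof.
rewrite /gaug; under eq_bigr => x _ do rewrite ffunE.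
rewrite (exchange_big_dep predT) //=; apply: eq_bigr => y _.
by rewrite (big_pred1 (y *+ k)) // => z; rewrite eq_sym.
Qed.

Lemma gpush_set_sum k A : gpush k (gset A) = \sum_(x in A) gbase (x *+ k).
Proof. by rewrite gset_sum raddf_sum; apply: eq_bigr => x _; rewrite /= gpush_base. Qed.

Lemma gpush_inj k f x : injective (fun y : G => y *+ k) -> gpush k f (x *+ k) = f x.
Proof. by move=> injk; rewrite ffunE (big_pred1 x) // => y; rewrite /= (inj_eq injk). Qed.

Lemma gpush_setE k A x :
  injective (fun y : G => y *+ k) -> gpush k (gset A) x = (x \in [set y *+ k | y in A])%:R.
Proof.
move=> injk; rewrite gpush_set_sum gsumE.
case: imsetP => [[y yA ->]|nx].
  rewrite (bigD1 y) //= ffunE eqxx big1 ?addr0 // => z /andP[_ zy].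
  by rewrite ffunE (inj_eq injk) eq_sym (negbTE zy).
by rewrite big1 // => y yA; rewrite ffunE; case: eqP => // xy; case: nx; exists y.
Qed.

Lemma gpush_setT k :
  injective (fun y : G => y *+ k) -> gpush k (gset [set: G]) = gset [set: G].
Proof.
move=> injk; apply/ffunP=> x; rewrite gpush_setE // ffunE in_setT.
have [k' _ injK] := injF_bij injk.
suff -> : x \in [set y *+ k | y in [set: G]] by [].
by apply/imsetP; exists (k' x); rewrite ?injK ?in_setT.
Qed.

(** Translation by [x] permutes [G], so it preserves the sum of all elements while adding [#|G|]
    copies of [x] to it. *)
Lemma mulrn_cardG x : x *+ #|G| = 0.
Proof.
have e : \sum_(y : G) y = \sum_(y : G) (y + x) by rewrite (reindex_inj (addIr x)).
by apply: (addrI (\sum_(y : G) y)); rewrite {2}e big_split /= sumr_const addr0.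
Qed.

Lemma mulrn_inj_coprime k : coprime k #|G| -> injective (fun y : G => y *+ k).
Proof.
case: k => [|k] ck x y /= e.
  (* Coprimality of 0 with the order forces the trivial group. *)
  have xN z : z = 0 :> G.
    by have := mulrn_cardG z; move: ck; rewrite /coprime gcd0n => /eqP ->.
  by rewrite [x]xN [y]xN.
have : (x - y) *+ k.+1 = 0 by rewrite mulrnBl e subrr.
case: (egcdnP #|G| (ltn0Sn k)) => a b ab _ xyk.
have : (x - y) *+ (a * k.+1) = (x - y) *+ (b * #|G| + gcdn k.+1 #|G|) by rewrite ab.
rewrite mulnC mulrnA xyk mul0rn (eqP ck) mulrnDr mulnC mulrnA mulrn_cardG mul0rn add0r.
by move/esym/subr0_eq.
Qed.

End GroupAlgebra.

(** Frobenius modulo 3, by induction from [(a + b)^3 = a^3 + b^3 + 3 a b (a + b)]. *)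
Lemma sum_cube (R : comNzRingType) (I : Type) (r : seq I) (P : pred I) (F : I -> R) :
  exists u, (\sum_(i <- r | P i) F i) ^+ 3 = \sum_(i <- r | P i) F i ^+ 3 + 3%:R * u.
Proof.
elim/big_rec2: _ => [|i a b _ [u]]; first by exists 0; ring.
by move=> e; exists (F i * b * (F i + b) + u); ring: e.
Qed.

Lemma sum_pow5 (R : comNzRingType) (I : Type) (r : seq I) (P : pred I) (F : I -> R) :
  exists u, (\sum_(i <- r | P i) F i) ^+ 5 = \sum_(i <- r | P i) F i ^+ 5 + 5%:R * u.
Proof.
elim/big_rec2: _ => [|i a b _ [u]]; first by exists 0; ring.
move=> e.
(* The mixed binomial terms of the fifth power, divided by 5. *)
exists (F i ^+ 4 * b + 2 * F i ^+ 3 * b ^+ 2 + 2 * F i ^+ 2 * b ^+ 3 + F i * b ^+ 4 + u).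
by ring: e.
Qed.

(** * Sets satisfying the radius-two equation *)

(* The group-ring form of a lattice tiling by Lee spheres of radius 2: [T] is
   the image of the unit Lee sphere in the quotient group. *)
Definition lee_set (G : finZmodType) (n : nat) (T : {set G}) : Prop :=
  [/\ 0 \in T, {in T, forall t, - t \in T}, #|T| = (2 * n + 1)%N &
      gset T * gset T = 2%:R * gset [set: G] - gpush 2 (gset T) + (2 * n)%:R].

Section LeeSet.

Variables (G : finZmodType) (n : nat) (T : {set G}).
Hypothesis leeT : lee_set n T.

Let T1 := gset T.
Let E := gset [set: G].
Definition Tp k := gpush k T1.
Definition TpT k := Tp k * T1.
Let N : int := 2 * n%:Z ^+ 2 + 2 * n%:Z + 1.

(** * Augmentations, the order of the group and its multiplication maps *)

Lemma gaugE (f : galg G) : gaug f = \sum_x f x. Proof. by []. Qed.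

Lemma gaug_nat (k : nat) : gaug (k%:R : galg G) = k.
Proof.
rewrite gaugE (bigD1 0) //= gnatE eqxx mulr1 big1 ?addr0 ?natz // => x /negbTE x0.
by rewrite gnatE x0 mulr0.
Qed.

Lemma gaug_T1 : gaug T1 = 2 * n%:Z + 1.
Proof. by case: leeT => _ _ c _; rewrite gaug_set c; lia. Qed.

Lemma gaug_Tp k : gaug (Tp k) = 2 * n%:Z + 1.
Proof. by rewrite gaug_push gaug_T1. Qed.

Lemma gaug_TpT k : gaug (TpT k) = (2 * n%:Z + 1) ^+ 2.
Proof. by rewrite gaugM gaug_Tp gaug_T1. Qed.

(** Augmentations in the defining equation give [(2 n + 1)^2 = 2 #|G| - (2 n + 1) + 2 n]. *)
Lemma card_lee : #|G| = (2 * n ^ 2 + 2 * n + 1)%N.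
Proof.
have [_ _ _ e] := leeT; have := congr1 (@gaug G) e.
have -> : gaug (2%:R * E - gpush 2 T1 + (2 * n)%:R) =
          2 * gaug E - gaug (gpush 2 T1) + gaug ((2 * n)%:R : galg G).
  rewrite !gaugE mulr_sumr -sumrB -big_split; apply: eq_bigr => x _ /=.
  by rewrite !gaddE goppE gnatmulE natz.
rewrite gaugM gaug_push !gaug_T1 gaug_nat gaug_set -(cardsT G) natz; lia.
Qed.

Lemma cardZ : #|G|%:Z = N.
Proof. by rewrite card_lee /N; lia. Qed.

Lemma coprime_modn_card p k :
  prime p -> (n %% p)%N = k -> ((2 * k ^ 2 + 2 * k + 1) %% p != 0)%N -> coprime p #|G|.
Proof.
move=> pp <- h; rewrite prime_coprime // card_lee /dvdn.
by rewrite -(modnDml (_ + _)) -(modnDm (2 * _)) -(modnMmr 2 (n ^ 2)) -(modnMmr 2 n) -modnXm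
   modnMmr modnDm modnDml.
Qed.

Lemma mulr2n_inj : injective (fun x : G => x *+ 2).
Proof.
apply: mulrn_inj_coprime; rewrite coprime2n card_lee; lia.
Qed.

Lemma mulr4n_inj : injective (fun x : G => x *+ 4).
Proof. by move=> x y; rewrite (mulrnA x 2 2) (mulrnA y 2 2) => /mulr2n_inj /mulr2n_inj. Qed.

Lemma mulr3n_inj : injective (fun x : G => x *+ 3).
Proof.
apply: mulrn_inj_coprime.
have : (n %% 3 < 3)%N by rewrite ltn_mod.
by case e : (n %% 3)%N => [|[|[|]]] // _; apply: (coprime_modn_card _ e).
Qed.

(** The residue matters here: 5 divides the order when [n] is 1 or 3 modulo 5. *)
Lemma mulr5n_inj : (n %% 5)%N = 0%N -> injective (fun x : G => x *+ 5).
Proof. by move=> e; apply: mulrn_inj_coprime; apply: (coprime_modn_card _ e). Qed.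

Lemma mem0T : 0 \in T. Proof. by case: leeT. Qed.

Lemma memN t : (- t \in T) = (t \in T).
Proof.
by have [_ h _ _] := leeT; apply/idP/idP => /h //; rewrite opprK.
Qed.

Lemma T1_ge0 x : 0 <= T1 x. Proof. by rewrite ffunE ler0n. Qed.

Lemma Tp_ge0 k x : 0 <= Tp k x.
Proof. by rewrite ffunE sumr_ge0 // => y _; exact: T1_ge0. Qed.

Lemma TpT_ge0 k x : 0 <= TpT k x.
Proof. by rewrite gmulE sumr_ge0 // => y _; rewrite mulr_ge0 ?Tp_ge0 ?T1_ge0. Qed.

Lemma T1N x : T1 (- x) = T1 x.
Proof. by rewrite !ffunE memN. Qed.

Lemma TpN k x : Tp k (- x) = Tp k x.
Proof.
rewrite !ffunE (reindex_inj oppr_inj) /=; apply: eq_big => [y|y _]; last exact: T1N.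
by rewrite mulNrn (inj_eq oppr_inj).
Qed.

Lemma TpTN k x : TpT k (- x) = TpT k x.
Proof.
rewrite !gmulE (reindex_inj oppr_inj) /=; apply: eq_bigr => y _.
by rewrite TpN -opprD T1N.
Qed.

Lemma E1 x : E x = 1. Proof. by rewrite ffunE in_setT. Qed.

Lemma T1E x : T1 x = (x \in T)%:R. Proof. by rewrite ffunE. Qed.

Lemma T1sq : T1 * T1 = 2%:R * E - Tp 2 + (2 * n)%:R. Proof. by case: leeT. Qed.

Lemma EM f : E * f = E * (gaug f)%:~R. Proof. exact: gmul_setT. Qed.

Lemma Tp_sq k : injective (fun x : G => x *+ k) ->
  Tp k * Tp k = 2%:R * E - Tp (2 * k) + (2 * n)%:R.
Proof.
move=> injk; rewrite -gpushM T1sq raddfD raddfB /= gpushM !gpush_nat.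
by rewrite gpush_setT // gpush_comp.
Qed.

Lemma Tp_val k x : injective (fun x : G => x *+ k) ->
  Tp k x = (x \in [set y *+ k | y in T])%:R.
Proof. exact: gpush_setE. Qed.

Lemma Tp_at0 k : injective (fun x : G => x *+ k) -> Tp k 0 = 1.
Proof. by move=> injk; rewrite -(mul0rn _ k) gpush_inj // ffunE mem0T. Qed.

(* A nonzero [2 u] has coefficient 1 in [T1 * T1]. *)
Lemma sum_double u y z : u \in T -> y \in T -> z \in T -> u != 0 ->
  y + z = u *+ 2 -> y = z.
Proof.
move=> uT yT zT u0 e; apply/eqP/negPn/negP => yz.
have := congr1 (fun f : galg G => f (u *+ 2)) T1sq.
rewrite /= gaddE gaddE goppE gnatmulE gnatE E1 gpush_inj; last exact: mulr2n_inj.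
rewrite T1E uT -(mul0rn _ 2) (inj_eq mulr2n_inj) (negbTE u0) -e gmulE.
(* If [y] and [z] differ, the pairs [(y, z)] and [(z, y)] alone contribute 2 to a coefficient equal
   to 1. *)
rewrite (bigD1 y) //= (bigD1 z) 1?eq_sym //= addrK [y + z]addrC addrK !T1E yT zT.
set s := \sum_(_ | _) _; have : 0 <= s.
  by apply: sumr_ge0 => i _; rewrite mulr_ge0 ?T1_ge0.
by lia.
Qed.

(** Applying [sum_double] to [0 + t = 2 u] makes [t] zero, and doubling is injective. *)
Lemma T_double t u : t \in T -> u \in T -> t = u *+ 2 -> u = 0.
Proof.
move=> tT uT e; apply/eqP/negPn/negP => u0.
have := sum_double uT mem0T tT u0; rewrite add0r => /(_ e) t0.
by move: u0; rewrite -(inj_eq mulr2n_inj) -e -t0 mul0rn eqxx.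
Qed.

(** Applying [sum_double] to [t + (- u) = 2 u] gives [t = - u], hence [4 u = 0]. *)
Lemma T_triple t u : t \in T -> u \in T -> t = u *+ 3 -> u = 0.
Proof.
move=> tT uT e; apply/eqP/negPn/negP => u0.
have := @sum_double u t (- u) uT tT; rewrite memN => /(_ uT u0) h.
have /h tu : t - u = u *+ 2 by rewrite e mulrSr addrK.
by move: u0; rewrite -(inj_eq mulr4n_inj) mulrSr -e tu addNr mul0rn eqxx.
Qed.

(** * Second moments *)

Lemma sum_sq_sym (f : galg G) : (forall x, f (- x) = f x) ->
  \sum_x f x ^+ 2 = (f * f) 0.
Proof. by move=> fN; rewrite gmulE; apply: eq_bigr => x _; rewrite sub0r fN expr2. Qed.

Lemma EE : E * E = E * (2 * n%:R ^+ 2 + 2 * n%:R + 1).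
Proof.
rewrite EM; congr (_ * _); rewrite gaug_set cardsT card_lee natz -pmulrn; ring.
Qed.

Lemma ETp k : E * Tp k = E * (2 * n%:R + 1).
Proof. rewrite EM gaug_Tp; congr (_ * _); ring. Qed.

Lemma ET1 : E * T1 = E * (2 * n%:R + 1).
Proof. rewrite EM gaug_T1; congr (_ * _); ring. Qed.

(** Regroup as [T(k)^2 T^2] and apply the equation to both factors; the cross term [T(2k) T(2)] is
    the image of [T(k) T] under doubling. *)
Lemma TpT_sq k : injective (fun x : G => x *+ k) ->
  TpT k * TpT k = E * (8 * n%:R ^+ 2 + 8 * n%:R) + gpush 2 (TpT k)
    - 2 * n%:R * Tp (2 * k) - 2 * n%:R * Tp 2 + 4 * n%:R ^+ 2.
Proof.
move=> injk; rewrite gpushM gpush_comp mulnC -!/(Tp _).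
have e1 := Tp_sq injk; have e2 := T1sq; have e3 := ETp (2 * k); have e4 := ETp 2.
have e5 := EE; rewrite /TpT.
have -> : Tp k * T1 * (Tp k * T1) = (Tp k * Tp k) * (T1 * T1) by ring.
by rewrite e1 e2; ring: e3 e4 e5.
Qed.

Lemma sum_TpT_sq k : injective (fun x : G => x *+ k) ->
  \sum_x TpT k x ^+ 2 = 12 * n%:Z ^+ 2 + 4 * n%:Z + TpT k 0.
Proof.
move=> injk; rewrite sum_sq_sym; last exact: TpTN.
have inj2k : injective (fun x : G => x *+ (2 * k)).
  by move=> x y; rewrite !mulrnA => /injk /mulr2n_inj.
have E0 (z : nat) : (E * z%:R) 0 = z%:Z by rewrite mulrC gnatmulE E1 mulr1 natz.
have -> : TpT k * TpT k = E * (8 * n ^ 2 + 8 * n)%:R + gpush 2 (TpT k)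
    - (2 * n)%:R * Tp (2 * k) - (2 * n)%:R * Tp 2 + (4 * n ^ 2)%:R.
  by rewrite TpT_sq //; ring.
rewrite !gaddE !goppE E0 !gnatmulE gnatE eqxx !Tp_at0 //; last exact: mulr2n_inj.
rewrite -[X in gpush _ _ X](mul0rn _ 2) gpush_inj; last exact: mulr2n_inj.
rewrite !natz; move: (TpT k 0) => t /=; lia.
Qed.

Lemma TpT2_0 : TpT 2 0 = 1.
Proof.
rewrite gmulE (bigD1 0) //= subr0 Tp_at0 ?T1E ?mem0T; last exact: mulr2n_inj.
rewrite big1 ?addr0 // => y y0; rewrite sub0r T1N T1E Tp_val; last exact: mulr2n_inj.
case: imsetP => [[u uT yu]|]; last by rewrite mul0r.
case: (boolP (y \in T)) => [yT|]; last by rewrite mulr0.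
by move: y0; rewrite yu (T_double yT uT yu) mul0rn eqxx.
Qed.

Lemma T1_Tp3 x : T1 x * Tp 3 x = (x == 0)%:R.
Proof.
rewrite T1E Tp_val; last exact: mulr3n_inj.
case: (eqVneq x 0) => [->|x0].
  rewrite mem0T; case: imsetP => // [[]]; by exists 0; rewrite ?mem0T ?mul0rn.
case: imsetP => [[u uT xu]|]; last by rewrite mulr0.
case: (boolP (x \in T)) => [xT|]; last by rewrite mul0r.
by move: x0; rewrite xu (T_triple xT uT xu) mul0rn eqxx.
Qed.

Lemma T1_01 x : T1 x = 0 \/ T1 x = 1.
Proof. by rewrite T1E; case: (x \in T); [right|left]. Qed.

Lemma Tp_01 k x : injective (fun x : G => x *+ k) -> Tp k x = 0 \/ Tp k x = 1.
Proof. by move=> injk; rewrite Tp_val //; case: (_ \in _); [right|left]. Qed.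

(** * Congruences modulo 3 and 5 *)

Lemma gcoefE (a b c d : nat) (f1 f2 f3 f4 : galg G) x :
  (a%:R * E + b%:R * f1 - c%:R * f2 - f3 - d%:R * f4) x =
  a%:Z + b%:Z * f1 x - c%:Z * f2 x - f3 x - d%:Z * f4 x.
Proof. by rewrite !gaddE !goppE !gnatmulE !natz E1 mulr1. Qed.

(** Two expressions of [T^3] are compared: [T T^2] expanded by the equation, and [T(3)] modulo 3. *)
Lemma TpT2_mod3 x : exists z,
  TpT 2 x = 2 * (2 * n%:Z + 1) + 2 * n%:Z * T1 x - Tp 3 x - 3 * z.
Proof.
have [u] := sum_cube (enum T) predT (@gbase G).
rewrite !big_enum /= -gset_sum => e; exists (u x).
have e3 : Tp 3 = \sum_(i in T) gbase i ^+ 3.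
  by rewrite /Tp gpush_set_sum; apply: eq_bigr => i _; rewrite gbaseX.
have -> : TpT 2 = (2 * (2 * n + 1))%:R * E + (2 * n)%:R * T1 - 0%:R * T1 - Tp 3 - 3%:R * u.
  have e1 := ET1; have e2 := T1sq; rewrite e3 /TpT.
  have -> : \sum_(i in T) gbase i ^+ 3 = T1 * (T1 * T1) - 3%:R * u.
    have -> : T1 * (T1 * T1) = T1 ^+ 3 by ring.
    by rewrite -/T1 in e *; ring: e.
  by rewrite e2; ring: e1.
by rewrite gcoefE; lia.
Qed.

(** Likewise with [T^5 = T (T^2)^2]: squaring [T^2] produces [T(2)^2], which the equation turns into
    [T(4)]. *)
Lemma TpT4_mod5 x : exists z,
  TpT 4 x = 2 * (2 * n%:Z + 1) ^+ 3 - 4 * n%:Z * TpT 2 x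
            + (4 * n%:Z ^+ 2 + 2 * n%:Z) * T1 x - Tp 5 x - 5 * z.
Proof.
have [u] := sum_pow5 (enum T) predT (@gbase G).
rewrite !big_enum /= -gset_sum => e; exists (u x).
have e5 : Tp 5 = \sum_(i in T) gbase i ^+ 5.
  by rewrite /Tp gpush_set_sum; apply: eq_bigr => i _; rewrite gbaseX.
have -> : TpT 4 = (2 * (2 * n + 1) ^ 3)%:R * E + (4 * n ^ 2 + 2 * n)%:R * T1
    - (4 * n)%:R * TpT 2 - Tp 5 - 5%:R * u.
  have e1 := ET1; have e2 := T1sq; have e3 := Tp_sq mulr2n_inj; have e4 := ETp 2.
  have e6 := EE.
  rewrite e5 /TpT.
  have -> : \sum_(i in T) gbase i ^+ 5 = T1 * ((T1 * T1) * (T1 * T1)) - 5%:R * u.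
    have -> : T1 * ((T1 * T1) * (T1 * T1)) = T1 ^+ 5 by ring.
    by rewrite -/T1 in e *; ring: e.
  have -> : T1 * T1 * (T1 * T1) = E * (8 * n%:R ^+ 2 + 8 * n%:R + 2) - Tp 4
     - 4 * n%:R * Tp 2 + 4 * n%:R ^+ 2 + 2 * n%:R.
    by rewrite e2; ring: e3 e4 e6.
  by ring: e1.
by rewrite gcoefE; lia.
Qed.

(** * Weighted sums of the coefficients *)

Let w x := TpT 4 x.
Let m x := TpT 2 x.
Let t3 x := Tp 3 x.
Let t5 x := Tp 5 x.
Let e0 (x : G) : int := (x == 0)%:R.

(** Brings quadratic inequalities within reach of [lia]: small values are substituted, larger
    squares are bounded below linearly. *)
Lemma small_or_square_ge (a : int) : 0 <= a ->
  [\/ a = 0, a = 1, a = 2 | [\/ a = 3, a = 4 | 5 <= a /\ 5 * a <= a ^+ 2]].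
Proof.
move=> a0; have : a = 0 \/ a = 1 \/ a = 2 \/ a = 3 \/ a = 4 \/ 5 <= a by lia.
case=> [->|[->|[->|[->|[->|a5]]]]].
- by constructor 1.
- by constructor 2.
- by constructor 3.
- by constructor 4; constructor 1.
- by constructor 4; constructor 2.
by constructor 4; constructor 3; split=> //; nia.
Qed.

(** The moments determine every sum except for the unknown [w 0], so a pointwise inequality becomes
    one in [n] and [w 0]. *)
Lemma sum_profile (a b c d f g h i j : int) :
  \sum_x (a + b * w x ^+ 2 + c * w x + d * m x ^+ 2 + f * m x
          + g * T1 x + h * t3 x + i * t5 x + j * e0 x) =
  a * N + b * (12 * n%:Z ^+ 2 + 4 * n%:Z + w 0) + c * (2 * n%:Z + 1) ^+ 2
  + d * (12 * n%:Z ^+ 2 + 4 * n%:Z + 1) + f * (2 * n%:Z + 1) ^+ 2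
  + (g + h + i) * (2 * n%:Z + 1) + j.
Proof.
rewrite !big_split /= -!mulr_sumr -!gaugE !gaug_TpT gaug_T1 !gaug_Tp.
rewrite (sum_TpT_sq mulr2n_inj) (sum_TpT_sq mulr4n_inj) TpT2_0 -/(w 0).
have -> : \sum_(x : G) a = a * N by rewrite -cardZ sumr_const -mulr_natr natz.
have -> : \sum_x e0 x = 1.
  by rewrite (bigD1 0) //= /e0 eqxx big1 ?addr0 // => x /negbTE ->.
ring.
Qed.

Lemma sum_profile_ge0 (a b c d f g h i j : int) :
  (forall x, 0 <= a + b * w x ^+ 2 + c * w x + d * m x ^+ 2 + f * m x
                  + g * T1 x + h * t3 x + i * t5 x + j * e0 x) ->
  0 <= a * N + b * (12 * n%:Z ^+ 2 + 4 * n%:Z + w 0) + c * (2 * n%:Z + 1) ^+ 2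
    + d * (12 * n%:Z ^+ 2 + 4 * n%:Z + 1) + f * (2 * n%:Z + 1) ^+ 2
    + (g + h + i) * (2 * n%:Z + 1) + j.
Proof. by move=> pos; rewrite -sum_profile sumr_ge0. Qed.

Lemma sum_profile_eq0 (a b c d f g h i j : int) :
  (forall x, 0 <= a + b * w x ^+ 2 + c * w x + d * m x ^+ 2 + f * m x
                  + g * T1 x + h * t3 x + i * t5 x + j * e0 x) ->
  a * N + b * (12 * n%:Z ^+ 2 + 4 * n%:Z + w 0) + c * (2 * n%:Z + 1) ^+ 2
    + d * (12 * n%:Z ^+ 2 + 4 * n%:Z + 1) + f * (2 * n%:Z + 1) ^+ 2
    + (g + h + i) * (2 * n%:Z + 1) + j = 0 ->
  forall x, a + b * w x ^+ 2 + c * w x + d * m x ^+ 2 + f * m x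
                  + g * T1 x + h * t3 x + i * t5 x + j * e0 x = 0.
Proof.
move=> pos; rewrite -sum_profile => s0 x.
by apply: (psumr_eq0P _ s0).
Qed.

Lemma T1_t3_cases x :
  [\/ [/\ T1 x = 1, t3 x = 1 & e0 x = 1], [/\ T1 x = 1, t3 x = 0 & e0 x = 0],
      [/\ T1 x = 0, t3 x = 1 & e0 x = 0] | [/\ T1 x = 0, t3 x = 0 & e0 x = 0]].
Proof.
rewrite /e0 /t3 -T1_Tp3.
case: (T1_01 x) => ->; case: (Tp_01 x mulr3n_inj) => ->; rewrite ?mulr0 ?mul0r ?mulr1.
- by constructor 4.
- by constructor 3.
- by constructor 2.
- by constructor 1.
Qed.

Lemma w0_le : w 0 <= 2 * n%:Z + 1.
Proof.
rewrite -(gaug_Tp 4) gaugE /w gmulE ler_sum // => y _.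
rewrite T1E; case: (_ \in _); rewrite ?mulr1 ?mulr0 //; exact: Tp_ge0.
Qed.

Lemma w_mod5 (r : nat) x : (n %% 5)%N = r -> exists z,
  w x = 2 * (2 * r%:Z + 1) ^+ 3 + r%:Z * m x + (4 * r%:Z ^+ 2 + 2 * r%:Z) * T1 x
        - t5 x + 5 * z.
Proof.
move=> nr; have [z] := TpT4_mod5 x; rewrite -/(w x) -/(m x) -/(t5 x) => ->.
have en : n%:Z = r%:Z + 5 * (n %/ 5)%:Z by lia.
move: en; set q := (n %/ 5)%:Z => ->; move: (m x) (T1 x) => a b.
pose u := 2 * r%:Z + 1.
(* The multiples of 5 left after substituting [n = r + 5 q]; for instance
   [- 4 n = r - 5 (r + 4 q)]. *)
exists (12 * q * u ^+ 2 + 120 * q ^+ 2 * u + 400 * q ^+ 3 - (r%:Z + 4 * q) * a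
        + (8 * r%:Z * q + 20 * q ^+ 2 + 2 * q) * b - z).
rewrite /u; ring.
Qed.

Lemma m_mod3 (r : nat) x : (n %% 3)%N = r -> exists z,
  m x = 2 * (2 * r%:Z + 1) + 2 * r%:Z * T1 x - t3 x + 3 * z.
Proof.
move=> nr; have [z] := TpT2_mod3 x; rewrite -/(m x) -/(t3 x) => ->.
have en : n%:Z = r%:Z + 3 * (n %/ 3)%:Z by lia.
move: en; set q := (n %/ 3)%:Z => ->; exists (4 * q + 2 * q * T1 x - z); ring.
Qed.

(* The quadratic bound in [h] sums to an equality, so it is sharp at every point. *)
Lemma m_values1 x : (n %% 3)%N = 1%N ->
  [\/ [/\ T1 x = 1, t3 x = 1, e0 x = 1 & m x = 1],
      [/\ T1 x = 1, t3 x = 0, e0 x = 0 & m x = 2],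
      [/\ T1 x = 0, t3 x = 1, e0 x = 0 & m x = 2] |
      [/\ T1 x = 0, t3 x = 0, e0 x = 0 & m x = 0 \/ m x = 3]].
Proof.
move=> n1.
(* Modulo 3, [m] is 1 at 0, 2 elsewhere on [T] and [3 T], and 0 off them. So [m (m - 3)] is at least
   -2 on these two sets and at least 0 off them; the remaining terms compensate exactly. *)
have h y : 0 <= 0 + 0 * w y ^+ 2 + 0 * w y + 1 * m y ^+ 2 + (-3) * m y
                  + 2 * T1 y + 2 * t3 y + 0 * t5 y + (-2) * e0 y.
  have [z] := m_mod3 y n1; have := TpT_ge0 2 y; rewrite -/(m y).
  move: (m y) (w y) (t5 y) => a b c /small_or_square_ge da.
  by case: (T1_t3_cases y) => -[-> -> ->]; case: da => [->|->|->|[->|->|[]]]; lia.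
have [z] := m_mod3 x n1.
have := sum_profile_eq0 h _ x; move/(_ ltac:(rewrite /N; ring)).
have := TpT_ge0 2 x; rewrite -/(m x).
move: (m x) (w x) (t5 x) => a b c /small_or_square_ge.
case: (T1_t3_cases x) => -[-> -> ->] da e em;
  [constructor 1|constructor 2|constructor 3|constructor 4].
all: by split=> //; case: da e em => [->|->|->|[->|->|[]]]; lia.
Qed.

Lemma m_at0 x : e0 x = 1 -> m x = 1.
Proof. by rewrite /e0; case: eqVneq => // -> _; exact: TpT2_0. Qed.

(** The argument for residue 1 with [(m - 1) (m - 4)] in place of [m (m - 3)]. At the origin both 1
    and 4 attain equality, and [m_at0] decides. *)
Lemma m_values2 x : (n %% 3)%N = 2%N ->
  [\/ [/\ T1 x = 1, t3 x = 1, e0 x = 1 & m x = 1],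
      [/\ T1 x = 1, t3 x = 0, e0 x = 0 & m x = 2],
      [/\ T1 x = 0, t3 x = 1, e0 x = 0 & m x = 3] |
      [/\ T1 x = 0, t3 x = 0, e0 x = 0 & m x = 1 \/ m x = 4]].
Proof.
move=> n1.
have h y : 0 <= 4 + 0 * w y ^+ 2 + 0 * w y + 1 * m y ^+ 2 + (-5) * m y
                  + 2 * T1 y + 2 * t3 y + 0 * t5 y + (-4) * e0 y.
  have [z] := m_mod3 y n1; have := TpT_ge0 2 y; rewrite -/(m y).
  move: (m y) (w y) (t5 y) => a b c /small_or_square_ge da.
  by case: (T1_t3_cases y) => -[-> -> ->]; case: da => [->|->|->|[->|->|[]]]; lia.
have [z] := m_mod3 x n1.
have := sum_profile_eq0 h _ x; move/(_ ltac:(rewrite /N; ring)).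
have := m_at0 (x := x); have := TpT_ge0 2 x; rewrite -/(m x).
move: (m x) (w x) (t5 x) => a b c /small_or_square_ge.
case: (T1_t3_cases x) => -[-> -> ->] da a1 e em;
  [constructor 1|constructor 2|constructor 3|constructor 4].
all: by split=> //; case: da a1 e em => [->|->|->|[->|->|[]]]; lia.
Qed.

(* Depending on [x], [w x] is [p - t5 x] modulo 5 with [p] in [0, 4] known from
   [m_values1] or [m_values2], so [w x >= p - t5 x] and
   [w x * (w x - 5) >= p * (p - 5) - 4 * t5 x].  The coefficients in the two lemmas
   below express three times [p] or [p * (p - 5)] as a combination of 1, [m], [T1],
   [t3] and [e0]. *)
Ltac profile_cases mv r5 :=
  let x := fresh "x" in intro x;
  move: (TpT_ge0 4 x) (Tp_ge0 5 x) (mv x) (w_mod5 x r5); rewrite -/(w x) -/(t5 x);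
  move: (m x) (w x) (t5 x) (T1 x) (t3 x) (e0 x) => ? ? ? ? ? ? /small_or_square_ge + ?;
  move=> + [[-> -> -> ->]|[-> -> -> ->]|[-> -> -> ->]|[-> -> -> [->|->]]];
  by move=> [->|->|->|[->|->|[? ?]]] [?]; lia.

Lemma mod3_1_mod5_neq0 : (3 <= n)%N -> (n %% 3)%N = 1%N -> (n %% 5)%N <> 0%N -> False.
Proof.
move=> n3 r3 r50; have w0 := w0_le.
have mv x := m_values1 x r3.
have : (n %% 5 < 5)%N by rewrite ltn_mod.
case r5 : (n %% 5)%N => [|[|[|[|[|]]]]] // _.
(* This residue uses the first moment of [w], the other three the second one through [w (w - 5)]. *)
- have := @sum_profile_ge0 (-12) 0 3 0 2 2 5 3 0.
  by move/(_ ltac:(profile_cases mv r5)); rewrite /N; move: (w 0) w0 => ww; nia.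
- have := @sum_profile_ge0 0 3 (-15) 0 4 4 4 12 6.
  by move/(_ ltac:(profile_cases mv r5)); rewrite /N; move: (w 0) w0 => ww; nia.
- have := @sum_profile_ge0 12 3 (-15) 0 (-4) 8 14 12 (-18).
  by move/(_ ltac:(profile_cases mv r5)); rewrite /N; move: (w 0) w0 => ww; nia.
- have := @sum_profile_ge0 18 3 (-15) 0 (-6) 12 6 12 (-18).
  by move/(_ ltac:(profile_cases mv r5)); rewrite /N; move: (w 0) w0 => ww; nia.
Qed.

Lemma mod3_2_mod5_neq0 : (3 <= n)%N -> (n %% 3)%N = 2%N -> (n %% 5)%N <> 0%N -> False.
Proof.
move=> n3 r3 r50; have w0 := w0_le.
have mv x := m_values2 x r3.
have : (n %% 5 < 5)%N by rewrite ltn_mod.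
case r5 : (n %% 5)%N => [|[|[|[|[|]]]]] // _.
(* Now residue 1 uses the second moment of [w], the other three the first. *)
- have := @sum_profile_ge0 (-6) 3 (-15) 0 6 12 6 12 (-6).
  by move/(_ ltac:(profile_cases mv r5)); rewrite /N; move: (w 0) w0 => ww; nia.
- have := @sum_profile_ge0 (-5) 0 3 0 (-1) (-5) 5 3 0.
  by move/(_ ltac:(profile_cases mv r5)); rewrite /N; move: (w 0) w0 => ww; nia.
- have := @sum_profile_ge0 (-13) 0 3 0 1 (-1) 10 3 0.
  by move/(_ ltac:(profile_cases mv r5)); rewrite /N; move: (w 0) w0 => ww; nia.
- have := @sum_profile_ge0 (-4) 0 3 0 (-2) (-1) 10 3 (-15).
  by move/(_ ltac:(profile_cases mv r5)); rewrite /N; move: (w 0) w0 => ww; nia.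
Qed.

(** * The residue 0 modulo 3 or 5 *)

Lemma sym_le_half_sum (f : G -> int) x :
  (forall y, 0 <= f y) -> (forall y, f (- y) = f y) -> x != 0 ->
  2 * f x + f 0 <= \sum_y f y.
Proof.
(* Doubling is injective, so [x] and [- x] are distinct and [f x] occurs twice in the sum. *)
move=> f0 fN x0; have xN : - x != x.
  apply: contra_neq x0 => xN; apply: mulr2n_inj.
  by rewrite /= mulr2n -{1}xN addNr mul0rn.
rewrite (bigD1 0) //= (bigD1 x) //= (bigD1 (- x)) ?oppr_eq0 ?x0 //= fN.
set s := \sum_(_ | _) _; have : 0 <= s by apply: sumr_ge0.
by move: (f 0) (f x) => a b; lia.
Qed.

Lemma mod3_0 : (3 <= n)%N -> (n %% 3)%N = 0%N -> False.
Proof.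
move=> n3 r3.
have mk x : exists2 k, 0 <= k & m x = 2 - t3 x + 3 * k.
  have [z ez] := m_mod3 x r3; exists z; last by lia.
  have := TpT_ge0 2 x; rewrite -/(m x) ez; case: (Tp_01 x mulr3n_inj); rewrite -/(t3 x) => ->; lia.
case: (ltngtP n 3) n3 => // [n3 _|n3 _].
  (* The excess of [m] over its least admissible value, that is three times the [k] of [mk]. *)
  pose f x := m x - 2 + t3 x.
  have f_ge0 x : 0 <= f x by rewrite /f; have [k k0 ->] := mk x; lia.
  have sf : \sum_x f x = 2 * n%:Z.
    have := @sum_profile (-2) 0 0 0 1 0 1 0 0.
    have -> : \sum_x (-2 + 0 * w x ^+ 2 + 0 * w x + 0 * m x ^+ 2 + 1 * m x
          + 0 * T1 x + 1 * t3 x + 0 * t5 x + 0 * e0 x) = \sum_x f x.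
      by apply: eq_bigr => x _; rewrite /f; ring.
    by move=> ->; rewrite /N; ring.
  have f_le x : f x <= n%:Z.
    case: (eqVneq x 0) => [->|x0].
      by rewrite /f /m TpT2_0 /t3 Tp_at0; [lia | exact: mulr3n_inj].
    have := sym_le_half_sum f_ge0 _ x0; rewrite sf.
    have fN y : f (- y) = f y by rewrite /f /m /t3 TpTN TpN.
    by move=> /(_ fN); have := f_ge0 0; lia.
  (* The summand is [f (n - f) + 2 t3 f], nonnegative since [f <= n]; the total is
     [- 2 n (n - 3)]. *)
  have := @sum_profile_ge0 (- 2 - 2 * (n%:Z + 1)) 0 0 (-1) (n%:Z + 4) 0 (n%:Z + 1) 0 0.
  have h x : 0 <= - 2 - 2 * (n%:Z + 1) + 0 * w x ^+ 2 + 0 * w x + (-1) * m x ^+ 2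
     + (n%:Z + 4) * m x + 0 * T1 x + (n%:Z + 1) * t3 x + 0 * t5 x + 0 * e0 x.
    have := f_ge0 x; have := f_le x; rewrite /f.
    by case: (Tp_01 x mulr3n_inj); rewrite -/(t3 x) => ->; nia.
  by move=> /(_ h); rewrite /N; nia.
(* For [n = 3] the total above is 0. The first moment of [w], with [m] inserted in its residue
   modulo 5, gives the total -45 instead. *)
have r5 : (n %% 5)%N = 3%N by rewrite n3.
have := @sum_profile_ge0 (-8) 0 3 0 1 (-6) (-5) 3 15.
have h x : 0 <= (-8) + 0 * w x ^+ 2 + 3 * w x + 0 * m x ^+ 2 + 1 * m x + (-6) * T1 x
   + (-5) * t3 x + 3 * t5 x + 15 * e0 x.
  have := TpT_ge0 4 x; rewrite -/(w x); have := Tp_ge0 5 x; rewrite -/(t5 x).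
  have [z ->] := w_mod5 x r5; have [k k0 ->] := mk x; move: (t5 x) => v v0.
  by case: (T1_t3_cases x) => -[-> -> ->]; lia.
by move=> /(_ h); rewrite /N n3; lia.
Qed.

(* Write [f = w - 2 + t5], which is a nonnegative multiple of 5, and [f 0 = 2 n - D].
   Away from 0 symmetry gives [2 * f <= D], and the second moment of [w] becomes
   [D * (8 n - 3 D - 6) <= 0]. *)
Lemma mod5_0_quadruple : (3 < n)%N -> (n %% 5)%N = 0%N -> Tp 4 = T1.
Proof.
move=> n3 r5; have inj5 := mulr5n_inj r5.
have wk x : exists2 k, 0 <= k & w x = 2 - t5 x + 5 * k.
  have [z ez] := w_mod5 x r5; exists z; last by lia.
  have := TpT_ge0 4 x; rewrite -/(w x) ez; case: (Tp_01 x inj5); rewrite -/(t5 x) => ->; lia.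
pose f x := w x - 2 + t5 x.
have f_ge0 x : 0 <= f x by rewrite /f; have [k k0 ->] := wk x; lia.
have sf : \sum_x f x = 2 * n%:Z.
  have := @sum_profile (-2) 0 1 0 0 0 0 1 0.
  have -> : \sum_x (-2 + 0 * w x ^+ 2 + 1 * w x + 0 * m x ^+ 2 + 0 * m x
        + 0 * T1 x + 0 * t3 x + 1 * t5 x + 0 * e0 x) = \sum_x f x.
    by apply: eq_bigr => x _; rewrite /f; ring.
  by move=> ->; rewrite /N; ring.
have f_le x : x != 0 -> 2 * f x + f 0 <= 2 * n%:Z.
  by rewrite -sf; apply: sym_le_half_sum => // y; rewrite /f /w /t5 TpTN TpN.
pose L := w 0 - 1; pose D := 2 * n%:Z - L.
have f0 : f 0 = L by rewrite /f /t5 Tp_at0 // /L; ring.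
have D_ge0 : 0 <= D by rewrite /D /L; have := w0_le; lia.
have L_ge0 : 0 <= L by rewrite -f0.
have D0 : D = 0.
  (* Away from 0 the summand is [f (D - 2 f) + 4 t5 f]; the coefficient of [e0] makes it vanish at
     0. As [D <= 2 n], the factor [8 n - 3 D - 6] of the total is positive. *)
  have := @sum_profile_ge0 (8 - 2 * (D + 8)) (-2) (D + 8) 0 0 0 0 (D + 2)
           (2 * L ^+ 2 - 4 * L - D * L).
  have h x : 0 <= 8 - 2 * (D + 8) + (-2) * w x ^+ 2 + (D + 8) * w x + 0 * m x ^+ 2
     + 0 * m x + 0 * T1 x + 0 * t3 x + (D + 2) * t5 x + (2 * L ^+ 2 - 4 * L - D * L) * e0 x.
    case: (eqVneq x 0) => [->|x0].
      rewrite /t5 Tp_at0 //; have -> : e0 0 = 1 by rewrite /e0 eqxx.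
      have -> : w 0 = L + 1 by rewrite /L; ring.
      by rewrite le_eqVlt; apply/orP; left; apply/eqP; ring.
    have -> : e0 x = 0 by rewrite /e0 (negbTE x0).
    have := f_le x x0; rewrite f0; have := f_ge0 x; rewrite /f /D.
    by case: (Tp_01 x inj5); rewrite -/(t5 x) => ->; nia.
  have D_le : D <= 2 * n%:Z by rewrite /D; lia.
  move=> /(_ h); have -> : w 0 = L + 1 by rewrite /L; ring.
  have -> : L = 2 * n%:Z - D by rewrite /D; ring.
  set e := (X in 0 <= X); have -> : e = - (D * (8 * n%:Z - 3 * D - 6)) by rewrite /e /N; ring.
  by move: D D_ge0 D_le {e h} => d *; nia.
(* [D = 0] means that [T] contains all [2 n + 1] elements of [4 T]; equal augmentations then give
   equality. *)
have T4le x : 0 <= T1 x - Tp 4 x.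
  suff /psumr_eq0P : \sum_y Tp 4 y * (1 - T1 y) = 0.
    have P y : 0 <= Tp 4 y * (1 - T1 y).
      by rewrite mulr_ge0 ?Tp_ge0 //; case: (T1_01 y) => ->.
    move=> /(_ (fun y _ => P y) x isT).
    by case: (T1_01 x) => ->; case: (Tp_01 x mulr4n_inj) => ->; lia.
  under eq_bigr => y _ do rewrite mulrBr mulr1.
  rewrite sumrB -gaugE gaug_Tp.
  have -> : \sum_y Tp 4 y * T1 y = w 0.
    by rewrite /w gmulE; apply: eq_bigr => y _; rewrite sub0r T1N.
  by move: D0; rewrite /D /L; lia.
apply/esym/ffunP => x; apply/eqP; rewrite -subr_eq0; apply/eqP; move: x isT.
apply: (psumr_eq0P (fun x _ => T4le x)).
by rewrite sumrB -!gaugE gaug_T1 gaug_Tp subrr.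
Qed.

Lemma mod5_0 : (3 <= n)%N -> (n %% 3)%N <> 0%N -> (n %% 5)%N = 0%N -> False.
Proof.
move=> n3 r30 r5.
have T4 : Tp 4 = T1 by apply: mod5_0_quadruple => //; lia.
(* Doubling sends [T(2) T] to [T(4) T(2) = T T(2)]. *)
have m2 x : m (x *+ 2) = m x.
  have e : gpush 2 (TpT 2) = TpT 2.
    by rewrite {1}/TpT gpushM gpush_comp -/(Tp 4) T4 mulrC.
  by rewrite /m -{1}e gpush_inj //; exact: mulr2n_inj.
have [t tT t0] : exists2 t, t \in T & t != 0.
  have /card_gt1P[x [y [xT yT xy]]] : (1 < #|T|)%N by case: leeT => _ _ -> _; lia.
  by have [x0|] := eqVneq x 0; [exists y; rewrite // -x0 eq_sym | exists x].
have et : e0 t = 0 by rewrite /e0 (negbTE t0).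
have Tt : T1 t = 1 by rewrite T1E tT.
have T2t : T1 (t *+ 2) = 0.
  rewrite T1E; case: (boolP (_ \in T)) => // tt.
  by rewrite (T_double tt tT erefl) eqxx in t0.
have : (n %% 3 < 3)%N by rewrite ltn_mod.
case r3 : (n %% 3)%N r30 => [|[|[|]]] // _ _.
  have mt : m t = 2 by case: (m_values1 t r3) => -[]; rewrite Tt et.
  have : t3 (t *+ 2) = 1.
    case: (m_values1 (t *+ 2) r3) => -[]; rewrite T2t m2 mt // => _ _ _.
    by case.
  rewrite /t3 Tp_val; last exact: mulr3n_inj.
  case: imsetP => // -[u uT tu] _.
  have T4mem v : v \in T -> v *+ 4 \in T.
    move=> vT; have := congr1 (fun f : galg G => f (v *+ 4)) T4.
    rewrite /= gpush_inj; last exact: mulr4n_inj.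
    by rewrite !T1E vT; case: (_ \in T).
  (* From [2 t = 3 u] follows [6 u = 4 t]. Now [6 u] and [- 4 u] are elements of [T] with sum [2 u],
     so [sum_double] yields [10 u = 0]. *)
  have u6 : u *+ 6 \in T by rewrite (mulrnA u 3 2) -tu -mulrnA T4mem.
  have u4 : - (u *+ 4) \in T by rewrite memN T4mem.
  have u0 : u != 0.
    apply: contra_neq t0 => u0; apply: mulr2n_inj.
    by rewrite /= tu u0 !mul0rn.
  have := sum_double uT u6 u4 u0; rewrite (mulrnDr u 4 2) addrAC subrr add0r => /(_ erefl).
  rewrite -mulrnDr => /eqP; rewrite -addr_eq0 -mulrnDr => /eqP u10.
  have /mulr2n_inj /= : (u *+ 5) *+ 2 = 0 *+ 2 by rewrite -mulrnA u10 mul0rn.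
  by rewrite -(mul0rn _ 5) => /(mulr5n_inj r5) /eqP; rewrite (negbTE u0).
(* In this class [m] takes only the values 1, 3 and 4 outside [T], whereas invariance gives 2 at
   [2 t]. *)
have mt : m t = 2 by case: (m_values2 t r3) => -[]; rewrite Tt et.
by case: (m_values2 (t *+ 2) r3) => -[]; rewrite T2t m2 mt // => _ _ _ [].
Qed.

Lemma lee_set_small : (n < 3)%N.
Proof.
rewrite ltnNge; apply/negP => n3.
have [r5|r5] := eqVneq (n %% 5)%N 0%N; have [r3|r3] := eqVneq (n %% 3)%N 0%N;
  try exact: mod3_0.
  by apply: mod5_0 => //; apply/eqP.
have : (n %% 3 < 3)%N by rewrite ltn_mod.
case e : (n %% 3)%N r3 => [|[|[|]]] // _ _.
  by apply: mod3_1_mod5_neq0 => //; apply/eqP.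
by apply: mod3_2_mod5_neq0 => //; apply/eqP.
Qed.

End LeeSet.

(** * From lattice tilings to group rings *)

(** Choosing for each class an index in [U] injects the quotient into a finite type. *)
Lemma fin_zmod_quotient (V : zmodType) (P : {pred V}) (U : finType) (s : U -> V) :
  GRing.zmod_closed P -> (forall v, exists u, v - s u \in P) ->
  exists (G : finZmodType) (p : V -> G),
    [/\ zmod_morphism p, forall g, exists v, p v = g & forall v, (p v == 0) = (v \in P)].
Proof.
move=> zP surj.
pose I : zmodClosed V := HB.pack_for (zmodClosed V) P (GRing.isZmodClosed.Build V P zP).
pose Q := Quotient.quot I.
pose p : V -> Q := \pi_Q%qT.
have pE v : (p v == 0) = (v \in P).
  rewrite -[0](raddf0 (\pi_Q%qT : {additive V -> Q})).
  by rewrite -[v in RHS]subr0 (Quotient.idealrBE I).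
have psurj (q : Q) : exists u, q == p (s u).
  have [u vu] := surj (repr q); exists u.
  by rewrite -subr_eq0 -[q]reprK -raddfB /= pE.
pose f q := xchoose (psurj q).
have fK : cancel f (p \o s) by move=> q; rewrite /= -(eqP (xchooseP (psurj q))).
pose Qc : countType := HB.pack Q (CanIsCountable fK).
pose Qf : finType := HB.pack Qc (@CanIsFinite Qc U f (p \o s) fK).
pose G : finZmodType := HB.pack Q (Finite.class Qf).
exists G, p; split=> //.
- by move=> x y; rewrite /p raddfB.
- by move=> q; exists (repr q); exact: reprK.
Qed.

(** * The unit Lee sphere and sums of two of its vectors *)

Section UnitBall.

Variable n : nat.

Definition wt (v : 'rV[int]_n) : int := \sum_(i < n) `|v 0 i|.

(* [None] indexes the origin, [Some (i, b)] the vector [e_i] or [- e_i]. *)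
Definition ball1 := option ('I_n * bool).

Definition ball1_vec (u : ball1) : 'rV[int]_n :=
  if u is Some (i, b) then (-1) ^+ b *: delta_mx 0 i else 0.

Arguments ball1_vec : simpl never.

Definition ball1_opp (u : ball1) : ball1 :=
  if u is Some (i, b) then Some (i, ~~ b) else None.

Lemma ball1_vecE u i :
  ball1_vec u 0 i = if u is Some (j, b) then (-1) ^+ b * (i == j)%:R else 0.
Proof. by case: u => [[j b]|]; rewrite /ball1_vec !mxE ?eqxx. Qed.

Lemma ball1_vec_opp u : ball1_vec (ball1_opp u) = - ball1_vec u.
Proof.
case: u => [[i []]|]; rewrite /ball1_vec /= ?oppr0 //.
  by rewrite expr1 expr0 scaleN1r opprK scale1r.
by rewrite expr1 expr0 scaleN1r scale1r.
Qed.

Lemma card_ball1 : #|{: ball1}| = (2 * n + 1)%N.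
Proof. by rewrite card_option card_prod card_ord card_bool; lia. Qed.

Lemma wtD v v' : wt (v + v') <= wt v + wt v'.
Proof. by rewrite /wt -big_split ler_sum // => i _; rewrite mxE ler_normD. Qed.

Lemma wt_ball1 u : wt (ball1_vec u) <= 1.
Proof.
rewrite /wt; under eq_bigr => i _ do rewrite ball1_vecE.
case: u => [[j b]|]; last by rewrite big1 // => i _; rewrite normr0.
rewrite (bigD1 j) //= eqxx mulr1 normrX normrN1 expr1n big1 ?addr0 // => i /negbTE ->.
by rewrite mulr0 normr0.
Qed.

Lemma wt_eq0 v : wt v <= 0 -> v = 0.
Proof.
move=> v0; have /psumr_eq0P e : wt v = 0.
  by apply/eqP; rewrite eq_le v0 sumr_ge0.
by apply/rowP => i; rewrite mxE; apply/eqP; rewrite -normr_eq0 e.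
Qed.

(** Moving a nonzero coordinate one step towards 0 lowers the norm by one. *)
Lemma wt_sub_ball1 v : v != 0 -> exists u, wt (v - ball1_vec u) <= wt v - 1.
Proof.
case/rV0Pn=> i vi; exists (Some (i, v 0 i < 0)).
have subE u j : (v - ball1_vec u) 0 j = v 0 j - ball1_vec u 0 j by rewrite 2!mxE.
rewrite /wt (bigD1 i) //= [X in _ <= X - 1](bigD1 i) //=.
have -> : \sum_(j < n | j != i) `|(v - ball1_vec (Some (i, v 0 i < 0))) 0 j| =
          \sum_(j < n | j != i) `|v 0 j|.
  by apply: eq_bigr => j /negbTE ji; rewrite subE ball1_vecE ji mulr0 subr0.
rewrite subE ball1_vecE eqxx mulr1.
move: (\sum_(_ | _) _) (v 0 i) vi => s a.
by case: (ltrP a 0) => /= a0 an0; rewrite ?expr1 ?expr0; lia.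
Qed.

Lemma ball1_vec_surj v : wt v <= 1 -> exists u, v = ball1_vec u.
Proof.
have [->|/wt_sub_ball1[u hu]] := eqVneq v 0; first by exists None.
move=> v1; exists u; apply/eqP; rewrite -subr_eq0; apply/eqP/wt_eq0.
by rewrite (le_trans hu) // subr_le0.
Qed.

Lemma ball2_sum v : wt v <= 2 -> exists u u', v = ball1_vec u + ball1_vec u'.
Proof.
have [->|/wt_sub_ball1[u hu]] := eqVneq v 0; first by exists None, None; rewrite addr0.
move=> v2; have [|u' e] := ball1_vec_surj (v := v - ball1_vec u).
  by rewrite (le_trans hu) // lerBlDr.
by exists u, u'; rewrite -e addrC subrK.
Qed.

Lemma ball1_vec_inj : injective ball1_vec.
Proof.
have key i b u : ball1_vec (Some (i, b)) = ball1_vec u -> u = Some (i, b).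
  move/rowP/(_ i); rewrite !ball1_vecE eqxx mulr1.
  case: u => [[j c]|]; last by case: b.
  by case: eqVneq => [->|_]; case: b; case: c.
case=> [[i b]|] u e; first by rewrite (key i b u).
by case: u e => [[i b]|] // /esym/key.
Qed.

(** As the sum is nonzero, [y] cannot cancel the [i]-th coordinate, which keeps the sign given by
    [b]; on the right only the same signed unit vector can produce that sign. *)
Lemma ball1_sum_mem i b y x' y' :
  ball1_vec (Some (i, b)) + ball1_vec y = ball1_vec x' + ball1_vec y' ->
  ball1_vec (Some (i, b)) + ball1_vec y != 0 -> Some (i, b) = x' \/ Some (i, b) = y'.
Proof.
move=> e ne0; have : y <> Some (i, ~~ b).
  by move=> yE; move: ne0; rewrite yE -[Some (i, ~~ b)]/(ball1_opp (Some (i, b)))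
    ball1_vec_opp subrr eqxx.
move/rowP/(_ i): e; rewrite mxE [RHS]mxE !ball1_vecE eqxx mulr1.
case: y {ne0} => [[j c]|]; case: x' => [[k c']|]; case: y' => [[l d]|];
  do ?[case: eqVneq => [<-|_]]; case: b; try case: c; try case: c'; try case: d;
  rewrite ?expr0 ?expr1 ?mulr1 ?mulr0 //=; try (by left); try (by right); by lia.
Qed.

Lemma ball1_sum_inj x y x' y' :
  ball1_vec x + ball1_vec y = ball1_vec x' + ball1_vec y' ->
  ball1_vec x + ball1_vec y != 0 ->
  (x = x' /\ y = y') \/ (x = y' /\ y = x').
Proof.
wlog : x y / x != None => [hw|].
  case: (eqVneq x None) => [->|x0]; last exact: hw.
  case: (eqVneq y None) => [->|y0]; first by rewrite addr0 eqxx.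
  by rewrite addrC => e ne; case: (hw y None y0 e ne) => [[-> ->]|[-> ->]]; [right|left].
case: x => [[i b]|] // _ e ne.
have [h|h] := ball1_sum_mem e ne; move: e; rewrite h => e.
  by left; split=> //; apply/ball1_vec_inj/(addrI _ e).
by right; split=> //; apply/ball1_vec_inj/(addrI (ball1_vec y')); rewrite e addrC.
Qed.

End UnitBall.

(** The tiling makes the quotient map a bijection from the sphere of radius 2 onto [G], so the
    coefficients of [T^2] count representations already in [Z^n]. *)
Lemma lattice_tiling_lee_set (n : nat) (C : set 'rV[int]_n) :
  lattice_tiling n 2 C -> exists (G : finZmodType) (T : {set G}), lee_set n T.
Proof.
case=> -[cov triv _] zC; have [C0 CB] := zC.
have memC v : (v \in mem C) = (v \in C) by [].
have sph v : lee_sphere n 2 v <-> wt v <= 2 by [].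
have wt2 (u u' : ball1 n) : wt (ball1_vec u + ball1_vec u') <= 2.
  by rewrite (le_trans (wtD _ _)) // (le_trans (lerD (wt_ball1 u) (wt_ball1 u'))).
(* The translates centred at [v - v'] and at 0 both contain [v]. *)
have inj2 v v' : wt v <= 2 -> wt v' <= 2 -> v - v' \in C -> v = v'.
  move=> v2 v'2 vC; apply/eqP; rewrite -subr_eq0; apply/eqP.
  apply: (triv (v - v') 0); [exact/set_mem|exact/set_mem|].
  exists v; split; first by exists v'; [exact/sph|rewrite addrC subrK].
  by exists v; [exact/sph|rewrite addr0].
have surj v : exists q : ball1 n * ball1 n, v - (ball1_vec q.1 + ball1_vec q.2) \in mem C.
  have : [set: 'rV[int]_n]%classic v by [].
  rewrite -cov => -[c Cc [s /sph/ball2_sum[u [u' ->]] <-]]; exists (u, u').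
  by rewrite addrC addKr; apply/mem_set.
have [G [p [pB psurj pE]]] := fin_zmod_quotient zC surj.
have p0 : p 0 = 0 by rewrite -(subrr 0) pB subrr.
have pN v : p (- v) = - p v by rewrite -[- v]add0r pB p0 add0r.
have pD v v' : p (v + v') = p v + p v' by rewrite -{1}[v']opprK pB pN opprK.
have pinj v v' : wt v <= 2 -> wt v' <= 2 -> p v = p v' -> v = v'.
  by move=> v2 v'2 e; apply: inj2 => //; rewrite -memC -pE pB e subrr.
pose P u := p (ball1_vec u).
have Pinj : injective P.
  move=> u u' e; apply: ball1_vec_inj; apply: pinj => //.
    exact: le_trans (wt_ball1 u) _.
  exact: le_trans (wt_ball1 u') _.
have Psum u u' a b : P u + P u' = P a + P b ->
    ball1_vec u + ball1_vec u' = ball1_vec a + ball1_vec b.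
  by move=> e; apply: pinj; rewrite ?wt2 // !pD.
have PN u : P (ball1_opp u) = - P u by rewrite /P ball1_vec_opp pN.
have P0 : P None = 0 by rewrite /P p0.
pose T := [set P u | u in [set: ball1 n]].
have gT : gset T = \sum_u gbase (P u).
  rewrite gset_sum big_imset /=; last by move=> u u' _ _; exact: Pinj.
  by apply: eq_bigl => u; rewrite in_setT.
exists G, T; split.
- by apply/imsetP; exists None; rewrite ?in_setT.
- by move=> _ /imsetP[u _ ->]; rewrite -PN imset_f ?in_setT.
- by rewrite card_imset // cardsT card_ball1.
apply/ffunP => g; rewrite !gaddE goppE gnatmulE gnatE [gset setT g]ffunE in_setT mulr1.
have -> : (gset T * gset T) g = #|[set q : ball1 n * ball1 n | P q.1 + P q.2 == g]|%:R.
  rewrite gT mulr_suml; under eq_bigr => u _ do rewrite mulr_sumr.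
  rewrite pair_big /= gsumE -sum1_card natr_sum [RHS]big_mkcond /=.
  apply: eq_bigr => q _; rewrite gbaseM ffunE inE [g == _]eq_sym.
  by case: (_ == _).
have -> : gpush 2 (gset T) g = #|[set u : ball1 n | P u *+ 2 == g]|%:R.
  rewrite gT raddf_sum gsumE -sum1_card natr_sum [RHS]big_mkcond /=.
  apply: eq_bigr => u _; rewrite gpush_base ffunE inE [g == _]eq_sym.
  by case: (_ == _).
have [v <-] := psurj g; have [[a b] /= vab] := surj v.
have {vab} -> : p v = P a + P b.
  by apply/eqP; rewrite -subr_eq0 /P -pD -pB pE.
(* At 0 there are the [2 n + 1] pairs of opposite vectors, matching [2 - 1 + 2 n]. *)
have [ab0|ab0] := eqVneq (P a + P b) 0.
  rewrite ab0.
  have -> : [set q : ball1 n * ball1 n | P q.1 + P q.2 == 0] =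
            [set (u, ball1_opp u) | u in [set: ball1 n]].
    apply/setP=> -[u u']; rewrite inE /=; apply/eqP/imsetP => [e|[u1 _ [-> ->]]].
      exists u; rewrite ?in_setT //; congr (_, _); apply: Pinj.
      by rewrite PN; apply/eqP; rewrite -addr_eq0 addrC e.
    by rewrite PN subrr.
  have -> : [set u : ball1 n | P u *+ 2 == 0] = [set None].
    apply/setP=> u; rewrite !inE; apply/eqP/eqP => [e|->]; last by rewrite P0 mul0rn.
    have /(Psum _ _ None None) : P u + P u = P None + P None by rewrite P0 addr0 -mulr2n e.
    move=> e0; apply: ball1_vec_inj; apply/rowP => i; move/rowP/(_ i): e0.
    by rewrite mxE [RHS]mxE; move: (ball1_vec u 0 i) (ball1_vec None 0 i) => c d; lia.
  rewrite card_imset ?cardsT ?card_ball1 ?cards1; last by move=> u u' [].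
  by rewrite !natz; lia.
have vab0 : ball1_vec a + ball1_vec b != 0.
  by apply: contra_neq ab0 => e; rewrite /P -pD e p0.
(* A nonzero sum fixes the unordered pair: two ordered pairs, or one when [a = b], exactly when the
   sum is a double. *)
have -> : [set q : ball1 n * ball1 n | P q.1 + P q.2 == P a + P b] = [set (a, b); (b, a)].
  apply/setP=> -[u u']; rewrite !inE /= !xpair_eqE.
  apply/eqP/orP => [/esym/Psum e|[/andP[/eqP-> /eqP->]|/andP[/eqP-> /eqP->]]] //; last first.
    by rewrite addrC.
  by case: (ball1_sum_inj e vab0) => [[-> ->]|[-> ->]]; rewrite !eqxx; [left|right].
have -> : [set u : ball1 n | P u *+ 2 == P a + P b] = if a == b then [set a] else set0.
  apply/setP=> u; rewrite inE; apply/eqP/idP.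
    rewrite mulr2n => /esym/Psum e.
    by case: (ball1_sum_inj e vab0) => [[-> ->]|[-> ->]]; rewrite eqxx inE.
  by case: eqVneq => [->|_]; rewrite inE // => /eqP ->; rewrite mulr2n.
rewrite cards2 xpair_eqE [b == a]eq_sym andbb mulr0 addr0.
by case: eqVneq => _; rewrite ?cards1 ?cards0.
Qed.

Theorem theorem1p3 (n : nat) (hn : (3 <= n)%N) :
  ~ exists C : set 'rV[int]_n, lattice_tiling n 2 C.
Proof.
case=> C /lattice_tiling_lee_set[G [T leeT]].
by have := lee_set_small leeT; rewrite ltnNge hn.
Qed.
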